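(* Let $G$ be a group, $N$ a normal subgroup of $G$ with inclusion $i\colon N\hookrightarrow G$, and $\Gamma=G/N$. Assume that $\mathrm{Q}(N)^G=\mathrm{H}^1(N)^G+i^*\mathrm{Q}(G)$. Then: (1) $\mathrm{scl}_G$ and $\mathrm{scl}_{G,N}$ are bi-Lipschitzly equivalent on $[G,N]$. (2) If $\Gamma$ is amenable, then $\mathrm{scl}_G(x)\le\mathrm{scl}_{G,N}(x)\le2\cdot\mathrm{scl}_G(x)$ for all $x\in[G,N]$. (3) If $\Gamma$ is solvable, then $\mathrm{scl}_G(x)=\mathrm{scl}_{G,N}(x)$ for all $x\in[G,N]$.
   Context: A quasimorphism on a group $G$ is a function $f\colon G\to\mathbb{R}$ with $\sup_{x,y\in G}|f(xy)-f(x)-f(y)|<\infty$; it is homogeneous if $f(x^n)=n f(x)$ for all $x\in G$, $n\in\mathbb{Z}$. $\mathrm{Q}(G)$ is the real vector space of homogeneous quasimorphisms on $G$. For a normal subgroup $N$ of $G$ with inclusion $i$: $\mathrm{Q}(N)^G$ is the space of $f\in\mathrm{Q}(N)$ with $f(gxg^{-1})=f(x)$ for all $g\in G$, $x\in N$; $\mathrm{H}^1(N)^G$ is the subspace of $G$-invariant homomorphisms $N\to\mathbb{R}$; $i^*\mathrm{Q}(G)\subseteq\mathrm{Q}(N)^G$ is the space of restrictions to $N$ of elements of $\mathrm{Q}(G)$. A $(G,N)$-commutator is an element $[g,x]=gxg^{-1}x^{-1}$ with $g\in G$, $x\in N$; $[G,N]$ is the subgroup they generate. For $x\in[G,N]$,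 $\mathrm{cl}_{G,N}(x)$ is the minimal $n$ such that $x$ is a product of $n$ $(G,N)$-commutators, and $\mathrm{scl}_{G,N}(x)=\lim_{n\to\infty}\mathrm{cl}_{G,N}(x^n)/n$ (the limit exists). $\mathrm{cl}_G=\mathrm{cl}_{G,G}$ and $\mathrm{scl}_G=\mathrm{scl}_{G,G}$. Two non-negative functions $\mu,\nu$ on a set are bi-Lipschitzly equivalent if there are positive constants $C_1,C_2$ with $C_1\nu\le\mu\le C_2\nu$. *)

(* Defs.v *)
From HB Require Import structures.
From mathcomp Require Import all_boot all_order all_algebra.
From mathcomp Require Import all_classical all_reals all_analysis.

Set Implicit Arguments.
Unset Strict Implicit.
Unset Printing Implicit Defensive.

Import Order.TTheory GRing.Theory Num.Theory.
Import numFieldNormedType.Exports.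

Local Open Scope classical_set_scope.
Local Open Scope ring_scope.
Local Open Scope group_scope.

HB.mixin Record isConjClosed (G : groupType) (S : {pred G}) := {
  gpred_conj : forall g x : G, x \in S -> g * x * g^-1 \in S
}.

#[short(type="normalSubgroup")]
HB.structure Definition NormalSubgroup (G : groupType) :=
  {S of isConjClosed G S & GroupClosed G S}.

(** A subgroup as a group in its own right; [val] is the inclusion. *)

Section Subgroup.
Variables (G : groupType) (N : groupClosed G).

Definition subgroup : Type := {x : G | x \in N}.

HB.instance Definition _ := [isSub of subgroup for @sval _ _].
HB.instance Definition _ := [Choice of subgroup by <:].

Lemma subgroup_closed : group_closed (mem N).
Proof. by split=> [|x y xN yN]; [exact: gpred1 | exact: gpredF]. Qed.

HB.instance Definition _ :=
  SubChoice_isSubGroup.Build G (mem N) subgroup subgroup_closed.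

End Subgroup.

Definition conj_normal (G : groupType) (N : normalSubgroup G) (g : G)
    (x : subgroup N) : subgroup N :=
  exist _ (g * val x * g^-1) (@gpred_conj G N g (val x) (valP x)).

(** The quotient group [G / N]: [same_coset x y] says that [x N = y N], and the
    operations are those of [G] on representatives. *)

Section Quotient.
Variables (G : groupType) (N : normalSubgroup G).

Definition same_coset (x y : G) : bool := x^-1 * y \in N.

Lemma same_coset_equiv : equiv_class_of same_coset.
Proof.
split=> [x|x y|y x z]; rewrite /same_coset.
- by rewrite mulVg gpred1.
- by rewrite -gpredV invgM invgK.
- move=> xyN yzN.
  have -> : x^-1 * z = (x^-1 * y) * (y^-1 * z) by rewrite -mulgA mulVKg.
  exact: gpredM.
Qed.

Canonical same_coset_equivRel := EquivRelPack same_coset_equiv.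

Definition quotient_group : Type := {eq_quot same_coset}%qT.

HB.instance Definition _ := Choice.on quotient_group.
HB.instance Definition _ :=
  EqQuotient.copy quotient_group {eq_quot same_coset}%qT.

Definition coset_class (x : G) : quotient_group := \pi_(quotient_group)%qT x.

Lemma coset_classP x y : coset_class x = coset_class y <-> x^-1 * y \in N.
Proof.
split=> [/eqP|xyN]; first by rewrite /coset_class eqquotE.
by apply/eqP; rewrite /coset_class eqquotE.
Qed.

Lemma repr_coset_class x : x^-1 * repr (coset_class x) \in N.
Proof. by apply/coset_classP; rewrite /coset_class reprK. Qed.

Definition quotient_mul (a b : quotient_group) := coset_class (repr a * repr b).
Definition quotient_one := coset_class 1.
Definition quotient_inv (a : quotient_group) := coset_class (repr a)^-1.

Lemma coset_classM x y :
  quotient_mul (coset_class x) (coset_class y) = coset_class (x * y).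
Proof.
apply/esym/coset_classP.
have xN := repr_coset_class x; have yN := repr_coset_class y.
set x' := repr _ in xN *; set y' := repr _ in yN *.
have -> : (x * y)^-1 * (x' * y') = y^-1 * (x^-1 * x') * y^-1^-1 * (y^-1 * y').
  by rewrite invgM invgK !mulgA mulgK.
by apply: gpredM yN; exact: gpred_conj.
Qed.

Lemma coset_classV x : quotient_inv (coset_class x) = coset_class x^-1.
Proof.
apply/esym/coset_classP; have := repr_coset_class x; set x' := repr _ => xN.
have -> : x^-1^-1 * x'^-1 = x * (x^-1 * x')^-1 * x^-1.
  by rewrite invgM !invgK !mulgA mulgK.
by apply: gpred_conj; rewrite gpredV.
Qed.

Lemma coset_class_ind (P : quotient_group -> Prop) :
  (forall x, P (coset_class x)) -> forall a, P a.
Proof. by move=> Px a; rewrite -[a]reprK; exact: Px. Qed.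

Lemma quotient_mulA : associative quotient_mul.
Proof.
elim/coset_class_ind=> x; elim/coset_class_ind=> y; elim/coset_class_ind=> z.
by rewrite !coset_classM mulgA.
Qed.

Lemma quotient_1mul : left_id quotient_one quotient_mul.
Proof. by elim/coset_class_ind=> x; rewrite coset_classM mul1g. Qed.

Lemma quotient_mul1 : right_id quotient_one quotient_mul.
Proof. by elim/coset_class_ind=> x; rewrite coset_classM mulg1. Qed.

Lemma quotient_Vmul : left_inverse quotient_one quotient_inv quotient_mul.
Proof. by elim/coset_class_ind=> x; rewrite coset_classV coset_classM mulVg. Qed.

Lemma quotient_mulV : right_inverse quotient_one quotient_inv quotient_mul.
Proof. by elim/coset_class_ind=> x; rewrite coset_classV coset_classM mulgV. Qed.

HB.instance Definition _ := isGroup.Build quotient_group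
  quotient_mulA quotient_1mul quotient_mul1 quotient_Vmul quotient_mulV.

End Quotient.

Definition expgz (G : groupType) (x : G) (n : int) : G :=
  match n with Posz m => x ^+ m | Negz m => x ^- m.+1 end.

Section Quasimorphisms.
Variable R : realType.
Local Open Scope ring_scope.

Definition quasimorphism (G : groupType) (f : G -> R) : Prop :=
  exists D : R, forall x y : G, `|f (x * y)%g - f x - f y| <= D.

Definition homogeneous (G : groupType) (f : G -> R) : Prop :=
  forall (x : G) (n : int), f (expgz x n) = n%:~R * f x.

Definition homogeneous_qm (G : groupType) : set (G -> R) :=
  [set f | quasimorphism f /\ homogeneous f].

Variables (G : groupType) (N : normalSubgroup G).

Definition conj_invariant (f : subgroup N -> R) : Prop :=
  forall (g : G) (x : subgroup N), f (conj_normal g x) = f x.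

(** [Q(N)^G] *)
Definition invariant_qm : set (subgroup N -> R) :=
  [set f | homogeneous_qm f /\ conj_invariant f].

(** [H^1(N)^G] *)
Definition invariant_hom : set (subgroup N -> R) :=
  [set f | (forall x y, f (x * y)%g = f x + f y) /\ conj_invariant f].

(** [i^* Q(G)] *)
Definition restricted_qm : set (subgroup N -> R) :=
  [set f \o val | f in homogeneous_qm (G := G)].

End Quasimorphisms.

Arguments homogeneous_qm R G _ : clear implicits.
Arguments invariant_qm R {G} N _.
Arguments invariant_hom R {G} N _.
Arguments restricted_qm R {G} N _.

Section Commutators.
Variable G : groupType.
Implicit Types (A B : set G) (N : {pred G}).

Definition commutator (g x : G) : G := g * x * g^-1 * x^-1.

Definition commutators A B : set G := [set commutator g x | g in A & x in B].

Definition generated A : set G :=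
  smallest [set H : set G | group_closed (fun x => x \in H)] A.

(** [[A, B]] *)
Definition commutator_subgroup A B : set G := generated (commutators A B).

Definition product_of_commutators N (n : nat) (x : G) : Prop :=
  exists s : seq G, [/\ size s = n,
    forall c, c \in s -> commutators setT [set` N] c & x = \prod_(c <- s) c].

(** [cl_{G,N}], with the junk value [0] outside [[G, N]]. *)
Definition cl N (x : G) : nat :=
  xget 0%N [set n | product_of_commutators N n x /\
                    forall m, product_of_commutators N m x -> (n <= m)%N].

(** [scl_{G,N}]; [scl_G] is [scl predT]. *)
Definition scl (R : realType) N (x : G) : R :=
  lim (((cl N (x ^+ n))%:R / n%:R : R)%R @[n --> \oo]).

Fixpoint derived_subgroup (n : nat) : set G :=
  if n is m.+1 then commutator_subgroup (derived_subgroup m) (derived_subgroup m)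
  else setT.

Definition solvable_group : Prop := exists n, derived_subgroup n = [set 1].

End Commutators.

Arguments scl {G} R N x.
Arguments solvable_group G : clear implicits.

(** Existence of a left-invariant mean on the bounded real functions; the values
    of [m] on unbounded functions are irrelevant. *)
Definition amenable (R : realType) (G : groupType) : Prop :=
  let bounded (f : G -> R) := exists C : R, forall x, (`|f x| <= C)%R in
  exists m : (G -> R) -> R,
    [/\ forall f h, bounded f -> bounded h -> m (f \+ h)%R = (m f + m h)%R,
        forall a f, bounded f -> m (fun x => a * f x)%R = (a * m f)%R,
        forall f, bounded f -> (forall x, (0 <= f x)%R) -> (0 <= m f)%R,
        m (fun=> 1%R) = 1%R &
        forall g f, bounded f -> m (fun x => f (g * x)) = m f].

Definition bilipschitz_equivalent_on (R : realType) (T : Type) (A : set T)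
    (mu nu : T -> R) : Prop :=
  exists C1 C2 : R, [/\ (0 < C1)%R, (0 < C2)%R &
    forall x, A x -> (C1 * nu x <= mu x <= C2 * nu x)%R].

(* Main.v *)
(** The proof rests on a mixed Bavard duality. On the one hand, an invariant
    homogeneous quasimorphism [f] on [N] of defect [D] satisfies
    [|f| <= 2 D scl_{G,N}] on [[G, N]]. On the other hand, for each [x] in
    [[G, N]] there is such an [f] of defect at most [1/2] with
    [f x >= scl_{G,N} x]: the growth rate of the mixed commutator length of
    [x_1^n ... x_k^n] does not depend on the order of the factors, hence gives a
    sublinear functional on the free abelian group on [N], which dominates [f]
    by Hahn-Banach. The defect bound comes from the fact that
    [a^n b^n (ab)^-n] is a product of [n / 2] commutators.

    By hypothesis [f] agrees on [[G, N]] with the restriction of a homogeneous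
    quasimorphism [f'] on [G], and [f'] has on [N] the same defect as [f]. So
    [scl_{G,N} x <= 2 D(f') scl_G x], and everything reduces to bounding the
    defect [D(f')] by that of its restriction to [N]. If [G / N] is solvable the
    two coincide, since in each abelian step [f' [a^n, b]] is close to
    [n f' [a, b]] but bounded. If [G / N] is amenable, averaging perturbs [f'] by
    a bounded amount to a function with the defect of the restriction, and
    homogenizing at most doubles the defect. In general, the uniform boundedness
    principle replaces these estimates. *)

Require Import Defs.
From mathcomp Require Import all_boot all_order all_algebra.
From mathcomp Require Import all_classical all_reals all_analysis.
From mathcomp Require Import lra ring zify.

Set Implicit Arguments.
Unset Strict Implicit.
Unset Printing Implicit Defensive.

Import Order.TTheory GRing.Theory Num.Theory.
Import numFieldNormedType.Exports.

Local Open Scope classical_set_scope.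
Local Open Scope ring_scope.

(** * Subadditive sequences and a Hahn-Banach theorem for abelian groups *)

(** The Archimedean property, used throughout to discard bounded errors: passing to [n]-th powers
    multiplies the wanted quantity by [n] but leaves the error fixed. *)
Lemma le0_of_mulrn_bounded (R : realType) (x B : R) :
  (forall n : nat, n%:R * x <= B) -> x <= 0.
Proof.
move=> nxB; rewrite leNgt; apply/negP => x0.
have B0 : 0 <= B by have := nxB 0%N; rewrite mul0r.
have := archi_boundP (divr_ge0 B0 (ltW x0)).
by rewrite ltr_pdivrMr// ltNge nxB.
Qed.

Lemma eq0_of_mulrn_bounded (R : realType) (x B : R) :
  (forall n : nat, n%:R * `|x| <= B) -> x = 0.
Proof. by move=> /le0_of_mulrn_bounded; rewrite normr_le0 => /eqP. Qed.

Section Fekete.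
Variables (R : realType) (a : nat -> nat).
Hypothesis subadd : forall m n, (a (m + n) <= a m + a n)%N.

Let ratios : set R := [set (a n)%:R / n%:R | n in [set n | (0 < n)%N]].

Let ratios_lb : has_lbound ratios.
Proof. by exists 0 => _ [n _ <-]; rewrite divr_ge0. Qed.

Let subadd_mul k n : (a (k.+1 * n) <= k.+1 * a n)%N.
Proof.
elim: k => [|k IH]; first by rewrite !mul1n.
by rewrite mulSn (leq_trans (subadd _ _))// mulSn leq_add2l.
Qed.

(** Fekete's lemma: fix [k] with [a k.+1 / k.+1] near the infimum and divide [n] by [k.+1]; the
    remainder contributes an amount independent of [n]. *)
Lemma subadditive_cvg : (a n)%:R / n%:R @[n --> \oo] --> inf ratios.
Proof.
have ratios_neq0 : ratios !=set0 by exists ((a 1)%:R / 1%:R), 1%N.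
apply/cvgrPdist_le => e e0.
have [_ [[//|k] _ <-] ak] :
    exists2 u, ratios u & u < inf ratios + e / 2.
  by apply: inf_adherent; [rewrite divr_gt0|split].
pose M := \sum_(i < k.+1) a i.
have a_le n : (a n <= (n %/ k.+1) * a k.+1 + M)%N.
  rewrite {1}(divn_eq n k.+1).
  have r_le : (a (n %% k.+1) <= M)%N.
    rewrite /M (bigD1 (Ordinal (ltn_pmod n (ltn0Sn k))))//=; exact: leq_addr.
  (* [a 0] may be positive, so a zero quotient is treated apart. *)
  case: (n %/ k.+1)%N => [|q]; first by rewrite mul0n add0n.
  exact: leq_trans (subadd _ _) (leq_add (subadd_mul _ _) r_le).
near=> n.
have n0 : (0 < n)%N by near: n; exact: nbhs_infty_gt.
have n0R : 0 < n%:R :> R by rewrite ltr0n.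
have lb : inf ratios <= (a n)%:R / n%:R by apply: ge_inf => //; exists n.
rewrite distrC ger0_norm ?subr_ge0// lerBlDl.
have Mn : M%:R <= n%:R * (e / 2).
  rewrite -ler_pdivrMr ?divr_gt0//.
  near: n.
  have := nbhs_infty_ge (Num.bound (M%:R / (e / 2) : R)); apply: filterS => n /=.
  rewrite -(ler_nat R); apply: le_trans; apply/ltW/archi_boundP.
  by rewrite divr_ge0// divr_ge0// ltW.
rewrite ler_pdivrMr//.
have k0R : 0 < k.+1%:R :> R by rewrite ltr0n.
have /(ler_wpM2l (ltW n0R)) : (a k.+1)%:R / k.+1%:R <= inf ratios + e / 2.
  exact: ltW.
have /(ler_wpM2r (divr_ge0 (ler0n R (a k.+1)) (ltW k0R))) :
    (n %/ k.+1)%:R * k.+1%:R <= n%:R :> R.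
  by rewrite -natrM ler_nat leq_trunc_div.
have := a_le n; rewrite -(ler_nat R) natrD natrM.
rewrite -mulrA (mulrC k.+1%:R) mulfVK ?gt_eqF//.
set A := (a n)%:R; set X := _ * _; set Y := _ * (_ / _).
move: Mn; rewrite mulrDr mulrDl => *.
lra.
Unshelve. all: by end_near. Qed.

Lemma subadditive_is_cvg : cvg (((a n)%:R / n%:R : R) @[n --> \oo]).
Proof. by apply/cvg_ex; eexists; exact: subadditive_cvg. Qed.

Lemma subadditive_lim_le n : (0 < n)%N ->
  lim (((a n)%:R / n%:R : R) @[n --> \oo]) <= (a n)%:R / n%:R.
Proof.
move=> n0; rewrite (cvg_lim _ subadditive_cvg)//.
by apply: ge_inf => //; exists n.
Qed.

End Fekete.

Section HahnBanach.
Variables (R : realType) (A : zmodType).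

(** [C (v, r)] encodes the constraint [f v <= r] on an unknown additive [f]. *)
Let bounded_cone (C : set (A * R)) : Prop :=
  [/\ C 0, forall p q, C p -> C q -> C (p + q),
      forall p, C p -> exists r, C (- p.1, r) &
      forall r, C (0, r) -> 0 <= r].

Let cone_mul C p n : bounded_cone C -> C p -> C (p *+ n).
Proof.
case=> C0 CD _ _ Cp; elim: n => [|n IH]; first by rewrite mulr0n.
by rewrite mulrS; exact: CD.
Qed.

Let extended_cone (C : set (A * R)) v r : set (A * R) :=
  [set p + (v, r) *~ k | p in C & k in [set: int]].

Let pair_mul (v : A) (r : R) n : (v, r) *+ n = (v *+ n, n%:R * r).
Proof.
elim: n => [|n IH]; first by rewrite !mulr0n mul0r.
by rewrite !mulrS IH mulrDl mul1r.
Qed.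

(** The future value [r] of [f v] must lie above [L] and below [U], the bounds forced by constraints
    on negative and positive multiples of [v]. Combining two such constraints into one on [0] shows
    that they are compatible. *)
Let cone_extension C v : bounded_cone C ->
  exists r, bounded_cone (extended_cone C v r).
Proof.
move=> coneC; have [C0 CD CN Cpos] := coneC.
pose L := [set r : R | exists n t, C (- v *+ n.+1, t) /\ r = - t / n.+1%:R].
pose U := [set r : R | exists n t, C (v *+ n.+1, t) /\ r = t / n.+1%:R].
have LU l u : L l -> U u -> l <= u.
  move=> [n [t [Ct ->]]] [m [s [Cs ->]]].
  rewrite ler_pdivrMr ?ltr0n// mulrAC ler_pdivlMr ?ltr0n//.
  rewrite mulNr -subr_ge0 opprK; apply: Cpos.
  have -> : (0, s * n.+1%:R + t * m.+1%:R) =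
      (v *+ m.+1, s) *+ n.+1 + (- v *+ n.+1, t) *+ m.+1.
    rewrite !pair_mul -!mulrnA mulnC mulNrn.
    by congr (_, _); rewrite /= ?subrr// ![_ * _%:R]mulrC.
  by apply: CD; exact: cone_mul.
(* Reversing a constraint turns a member of [L] into one of [U] and conversely, so both sets are
   empty or neither is. *)
have [r [rL rU]] : exists r, (forall l, L l -> l <= r) /\
    (forall u, U u -> r <= u).
  case: (pselect (L !=set0)) => [L0|L0].
    case: (pselect (U !=set0)) => [[u Uu]|U0].
      exists (sup L); split=> [l Ll|u' Uu'].
        by apply: ub_le_sup => //; exists u => ? ?; exact: LU.
      by apply: ge_sup => // l Ll; exact: LU.
    have [l [n [t [Ct _]]]] := L0.
    have [s Cs] := CN _ Ct; case: U0; exists (s / n.+1%:R), n, s.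
    by split=> //; move: Cs; rewrite /= mulNrn opprK.
  case: (pselect (U !=set0)) => [[u [n [t [Ct _]]]]|U0].
    have [s Cs] := CN _ Ct; case: L0; exists (- s / n.+1%:R), n, s.
    by split=> //; rewrite mulNrn.
  by exists 0; split=> [l Ll|u Uu]; [case: L0; exists l|case: U0; exists u].
exists r; split.
- by exists 0 => //; exists 0 => //; rewrite mulr0z addr0.
- move=> _ _ [p Cp [k _ <-]] [q Cq [l _ <-]].
  exists (p + q); first exact: CD.
  by exists (k + l) => //; rewrite mulrzDr addrACA.
- move=> _ [p Cp [k _ <-]]; have [s Cs] := CN _ Cp.
  exists (s + ((v, r) *~ (- k)).2), (- p.1, s) => //.
  exists (- k) => //; rewrite mulrNz; case: p {Cp Cs} => p1 p2 /=.
  by case: (_ *~ k) => x y /=; congr (_, _); rewrite /= ?opprD.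
- move=> t [[w s] Cws [[n|n] _]].
    rewrite -pmulrn; case: n => [|n].
      by rewrite mulr0n addr0 => -[w0 <-]; apply: Cpos; rewrite -w0.
    rewrite pair_mul => -[/eqP]; rewrite addr_eq0 => /eqP wE <-.
    have /rL : L (- s / n.+1%:R) by exists n, s; rewrite mulNrn -wE.
    by rewrite ler_pdivrMr ?ltr0n// mulrC -subr_ge0 opprK addrC.
  rewrite NegzE mulrNz -pmulrn pair_mul => -[/eqP]; rewrite subr_eq0 => /eqP wE <-.
  have /rU : U (s / n.+1%:R) by exists n, s; rewrite -wE.
  by rewrite ler_pdivlMr ?ltr0n// mulrC subr_ge0.
Qed.

(** By [cone_extension], a maximal cone contains for each [v] some [(v, r)] together with its
    opposite, and this [r] is [f v]. Zorn's lemma ranges over the sets joined to [C], so that the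
    empty chain causes no trouble. *)
Theorem hahn_banach_cone (C : set (A * R)) :
  C 0 -> (forall p q, C p -> C q -> C (p + q)) ->
  (forall v r, C (v, r) -> exists s, C (- v, s)) ->
  (forall r, C (0, r) -> 0 <= r) ->
  exists f : A -> R, (forall v w, f (v + w) = f v + f w) /\
    (forall v r, C (v, r) -> f v <= r).
Proof.
move=> C0 CD CN Cpos.
have [F FP totF|M [coneM maxM]] :=
    @Zorn_bigcup _ [set X | bounded_cone (C `|` X)].
  have [->|/set0P[X0 FX0]] := eqVneq F set0.
    rewrite bigcup_set0 /= setU0; split=> // -[v r]; exact: CN.
  have from_member p : (C `|` \bigcup_(X in F) X) p ->
      exists2 X, F X & (C `|` X) p.
    case=> [Cp|[X FX Xp]]; first by exists X0 => //; left.
    by exists X => //; right.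
  have to_union X p : F X -> (C `|` X) p -> (C `|` \bigcup_(X in F) X) p.
    by move=> FX [Cp|Xp]; [left|right; exists X].
  split.
  - by left.
  - move=> p q /from_member[X FX Xp] /from_member[Y FY Yq].
    have [XY|YX] := totF _ _ FX FY.
      have [_ YD _ _] := FP _ FY.
      by apply: (to_union _ _ FY); apply: YD Yq; case: Xp => [|/XY]; [left|right].
    have [_ XD _ _] := FP _ FX.
    by apply: (to_union _ _ FX); apply: XD Xp _; case: Yq => [|/YX]; [left|right].
  - move=> p /from_member[X FX Xp]; have [_ _ XN _] := FP _ FX.
    by have [r Xr] := XN _ Xp; exists r; exact: to_union FX _.
  - by move=> r /from_member[X FX Xp]; have [_ _ _] := FP _ FX; exact.
have determined v : exists r, (C `|` M) (v, r) /\ (C `|` M) (- v, - r).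
  have [r coneE] := cone_extension v coneM.
  set E := extended_cone _ _ _ in coneE.
  have [M0 _ _ _] := coneM.
  have subE : C `|` M `<=` E.
    by move=> p Mp; exists p => //; exists 0 => //; rewrite mulr0z addr0.
  have EM : E `<=` M.
    apply: contrapT => nEM; apply: (maxM E).
      by split=> // p Mp; apply: subE; right.
    by rewrite /= (_ : C `|` E = E)//; apply/setUidPr => p Cp; apply: subE; left.
  exists r; split; right; apply: EM; exists 0 => //.
    by exists 1 => //; rewrite add0r mulr1z.
  by exists (-1) => //; rewrite add0r mulrN1z.
have [f fP] := choice determined.
have [M0 MD _ Mpos] := coneM.
exists f; split=> [v w|v r Cvr].
  apply/eqP; rewrite eq_le; apply/andP; split; rewrite -subr_ge0; apply: Mpos.
    rewrite (_ : (0, _) = (v, f v) + (w, f w) + (- (v + w), - f (v + w))).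
      exact: MD (MD _ _ (fP v).1 (fP w).1) (fP (v + w)).2.
    by congr (_, _); rewrite /= subrr.
  rewrite (_ : (0, _) = (- v, - f v) + (- w, - f w) + (v + w, f (v + w))).
    exact: MD (MD _ _ (fP v).2 (fP w).2) (fP (v + w)).1.
  by congr (_, _); rewrite /= -opprD ?addNr// addrC.
rewrite -subr_ge0; apply: Mpos.
rewrite (_ : (0, _) = (v, r) + (- v, - f v)); first exact: MD (or_introl Cvr) (fP v).2.
by congr (_, _); rewrite /= subrr.
Qed.

End HahnBanach.

(** A list stands for its multiplicity function, so differences of lists form the free abelian group
    on [T] inside [T -> int]; [C l l' r] constrains the difference of [l] and [l']. *)
Lemma hahn_banach_seq (R : realType) (T : eqType)
    (C : seq T -> seq T -> R -> Prop) :
  C [::] [::] 0 ->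
  (forall l l' r m m' s, C l l' r -> C m m' s -> C (l ++ m) (l' ++ m') (r + s)) ->
  (forall l l' r, C l l' r -> exists s, C l' l s) ->
  (forall l l' r, C l l' r -> perm_eq l l' -> 0 <= r) ->
  exists f : T -> R, forall l l' r, C l l' r ->
    \sum_(x <- l) f x <= \sum_(x <- l') f x + r.
Proof.
move=> C0 CD CN Cpos.
pose mass (l : seq T) : T -> int := fun x => (count_mem x l)%:Z.
have massD l m : mass (l ++ m) = mass l + mass m.
  by apply/funext => x; rewrite /mass count_cat PoszD.
have [|||r|f [fD fC]] := @hahn_banach_cone R (T -> int)
    [set p | exists l l', p.1 = mass l - mass l' /\ C l l' p.2].
- by exists [::], [::]; split => //=; rewrite subrr.
- move=> p q [l [l' [pE Cp]]] [m [m' [qE Cq]]].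
  exists (l ++ m), (l' ++ m'); split; last exact: CD.
  by rewrite /= pE qE !massD opprD addrACA.
- move=> v r [l [l' /= [-> /CN[s Cs]]]].
  by exists s, l', l; rewrite opprB.
- move=> [l [l' /= [/esym/eqP]]]; rewrite subr_eq0 => /eqP massE /Cpos; apply.
  by apply/allP => x _ /=; have /(congr1 (@^~ x)) [->] := massE.
have f0 : f 0 = 0.
  by apply: (@addrI _ (f 0)); rewrite -fD !addr0.
have fN v : f (- v) = - f v.
  by apply/eqP; rewrite -addr_eq0 -fD addNr f0.
have f_mass l : f (mass l) = \sum_(x <- l) f (mass [:: x]).
  elim: l => [|x l IH]; last by rewrite big_cons -cat1s massD fD IH.
  by rewrite big_nil -f0; congr f; apply/funext.
exists (fun x => f (mass [:: x])) => l l' r Cr.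
rewrite -!f_mass addrC -lerBlDr -fN -fD; apply: fC.
by exists l, l'.
Qed.

(** * Commutator lengths *)

Section CommutatorLength.
Variable G : groupType.
Local Open Scope group_scope.

(** One commutator lowers both exponents by two and leaves a factor [(x * y) ^+ 2]; iterating
    reaches [(x * y) ^+ n] after [n./2] commutators. *)
Lemma mul_powers_commutator (x y : G) n :
  x ^+ n.+2 * y ^+ n.+2 =
  commutator (x ^+ n.+1 * y ^- n * x ^- n) (x ^+ n * y ^+ n * x * y * x ^- n) *
  (x ^+ n * y ^+ n * (x * y) ^+ 2).
Proof.
rewrite /commutator expg2 !expgSr.
rewrite !(invgM, invgK, mulgA, mulgVK, mulgK, mulVg, mul1g).
by rewrite -!(mulgA (x ^+ n)) -!(mulgA x) -!(mulgA y) -!expgSr -!expgS.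
Qed.

Section AnySubset.
Variable N : {pred G}.

Lemma product_of_commutators1 : product_of_commutators N 0 1.
Proof. by exists [::]; split=> //; rewrite big_nil. Qed.

Lemma product_of_commutatorsM j k x y : product_of_commutators N j x ->
  product_of_commutators N k y -> product_of_commutators N (j + k) (x * y).
Proof.
move=> [s [<- sC ->]] [t [<- tC ->]].
exists (s ++ t); split; [exact: size_cat| |by rewrite big_cat].
by move=> c; rewrite mem_cat => /orP[/sC|/tC].
Qed.

Lemma product_of_commutatorsX k x n : product_of_commutators N k x ->
  product_of_commutators N (n * k) (x ^+ n).
Proof.
move=> xk; elim: n => [|n IH].
  by rewrite mul0n expg0; exact: product_of_commutators1.
by rewrite mulSn expgS; exact: product_of_commutatorsM.
Qed.

Lemma product_of_commutators_commutator g x : x \in N ->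
  product_of_commutators N 1 (commutator g x).
Proof.
move=> xN; exists [:: commutator g x]; split=> //; last by rewrite big_seq1.
by move=> c; rewrite inE => /eqP->; exists g => //; exists x.
Qed.

Lemma product_of_commutators_ind (P : nat -> G -> Prop) : P 0%N 1 ->
  (forall k g x y, x \in N -> product_of_commutators N k y -> P k y ->
    P k.+1 (commutator g x * y)) ->
  forall k x, product_of_commutators N k x -> P k x.
Proof.
move=> P1 PS k x [s [<- + ->]]; elim: s => [|c s IH] sC; first by rewrite big_nil.
have [|g _ [y yN <-]] := sC c; first by rewrite inE eqxx.
rewrite big_cons; apply: PS => //.
  by exists s; split=> // d ds; apply: sC; rewrite inE ds orbT.
by apply: IH => d ds; apply: sC; rewrite inE ds orbT.
Qed.

(** Once some product exists, so does a shortest one, and [cl] does not take its default value. *)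
Lemma cl_spec k x : product_of_commutators N k x ->
  product_of_commutators N (cl N x) x /\ (cl N x <= k)%N.
Proof.
move=> xk; rewrite /cl.
case: xgetP => [n _ [nx nmin]|noN]; first by split=> //; exact: nmin.
have exn : exists n, `[< product_of_commutators N n x >] by exists k; apply/asboolP.
case: (ex_minnP exn) => n /asboolP nx nmin.
by case: (noN n); split=> // m /asboolP /nmin.
Qed.

Section Stable.
Variables (R : realType) (k : nat) (x : G).
Hypothesis xk : product_of_commutators N k x.

Let cl_subadditive m n : (cl N (x ^+ (m + n)) <= cl N (x ^+ m) + cl N (x ^+ n))%N.
Proof.
have [xm _] := cl_spec (product_of_commutatorsX m xk).
have [xn _] := cl_spec (product_of_commutatorsX n xk).
have xmn : product_of_commutators N (cl N (x ^+ m) + cl N (x ^+ n)) (x ^+ (m + n)).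
  by rewrite expgnDr; exact: product_of_commutatorsM.
by have [] := cl_spec xmn.
Qed.

Local Open Scope ring_scope.

Lemma scl_is_cvg :
  cvg (((cl N (x ^+ n)%g)%:R / n%:R : R) @[n --> \oo]).
Proof. exact: subadditive_is_cvg. Qed.

Lemma scl_le_cl n : n%:R * scl R N x <= (cl N (x ^+ n)%g)%:R.
Proof.
case: n => [|n]; first by rewrite mul0r.
rewrite mulrC -ler_pdivlMr ?ltr0n//.
exact: (@subadditive_lim_le R (fun n => cl N (x ^+ n)%g)).
Qed.

Lemma scl_ge c : (forall n, n%:R * c <= (cl N (x ^+ n)%g)%:R) -> c <= scl R N x.
Proof.
move=> cle; apply: limr_ge; first exact: scl_is_cvg.
near=> n; rewrite ler_pdivlMr 1?mulrC//.
by rewrite ltr0n; near: n; exact: nbhs_infty_gt.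
Unshelve. all: by end_near. Qed.

Lemma scl_ge0 : 0 <= scl R N x.
Proof. by apply: scl_ge => n; rewrite mulr0. Qed.

End Stable.

End AnySubset.

Lemma product_of_commutators_sub (N M : {pred G}) k x : {subset N <= M} ->
  product_of_commutators N k x -> product_of_commutators M k x.
Proof.
move=> NM [s [sk sC ->]]; exists s; split=> // c /sC [g _ [y yN <-]].
by exists g => //; exists y => //; exact: NM.
Qed.

Lemma scl_sub (R : realType) (N M : {pred G}) k x : {subset N <= M} ->
  product_of_commutators N k x -> (scl R M x <= scl R N x)%R.
Proof.
move=> NM xk; have xkM := product_of_commutators_sub NM xk.
apply: ler_lim; [exact: (@scl_is_cvg M R k)|exact: (@scl_is_cvg N R k)|].
near=> n; rewrite ler_wpM2r// ler_nat.
have [xn _] := cl_spec (product_of_commutatorsX n xk).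
by have [] := cl_spec (product_of_commutators_sub NM xn).
Unshelve. all: by end_near. Qed.

Section Normal.
Variable N : normalSubgroup G.

Lemma product_of_commutators_mem k x : product_of_commutators N k x -> x \in N.
Proof.
move: k x; apply: product_of_commutators_ind => [|k g x y xN _ yN]; first exact: gpred1.
by rewrite gpredM// gpredF// gpred_conj.
Qed.

Lemma product_of_commutatorsJ k x g : product_of_commutators N k x ->
  product_of_commutators N k (g * x * g^-1).
Proof.
move: k x; apply: product_of_commutators_ind => [|k h x y xN _ IH].
  by rewrite mulg1 mulgV; exact: product_of_commutators1.
have -> : g * (commutator h x * y) * g^-1 =
    commutator (g * h * g^-1) (g * x * g^-1) * (g * y * g^-1).
  by rewrite /commutator !(invgM, invgK, mulgA, mulgVK).
rewrite -[k.+1]add1n; apply: product_of_commutatorsM => //.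
exact/product_of_commutators_commutator/gpred_conj.
Qed.

Lemma product_of_commutatorsV k x : product_of_commutators N k x ->
  product_of_commutators N k x^-1.
Proof.
move: k x; apply: product_of_commutators_ind => [|k g x y xN _ IH].
  by rewrite invg1; exact: product_of_commutators1.
(* The inverse of a commutator is again one, with second entry conjugated; normality keeps that
   entry in [N]. *)
have -> : (commutator g x * y)^-1 = y^-1 * commutator g^-1 (g * x * g^-1).
  by rewrite /commutator !(invgM, invgK, mulgA, mulgVK, mulgK, mulVg, mul1g).
rewrite -addn1; apply: product_of_commutatorsM => //.
exact/product_of_commutators_commutator/gpred_conj.
Qed.

Lemma commutator_subgroup_product x :
  commutator_subgroup [set: G] [set` N] x ->
  exists k, product_of_commutators N k x.
Proof.
move: x; apply: (@smallest_sub _ _ _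
  [set x | exists k, product_of_commutators N k x]) => [|_ [g _ [y yN <-]]]; last first.
  by exists 1%N; exact: product_of_commutators_commutator.
split=> [|y z]; first by apply/mem_set; exists 0%N; exact: product_of_commutators1.
move=> /set_mem[j yj] /set_mem[k zk]; apply/mem_set; exists (j + k)%N.
exact/product_of_commutatorsM/product_of_commutatorsV.
Qed.

End Normal.

End CommutatorLength.

(** * Mixed Bavard duality *)

Definition defect_on (R : realType) (G : groupType) (H : set G) (D : R)
    (f : G -> R) : Prop :=
  forall x y, H x -> H y -> `|f (x * y)%g - f x - f y| <= D.

(** [f] restricts to an element of [Q(N)^G] of defect at most [D]; its values
    outside [N] are irrelevant. *)
Definition invariant_qm_on (R : realType) (G : groupType) (N : normalSubgroup G)
    (D : R) (f : G -> R) : Prop :=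
  [/\ defect_on [set` N] D f,
      forall x n, x \in N -> f (x ^+ n)%g = n%:R * f x &
      forall g x, x \in N -> f (g * x * g^-1)%g = f x].

Section BavardDuality.
Variables (R : realType) (G : groupType) (N : normalSubgroup G).
Implicit Types (a b c : nat -> G) (l : seq G).
Local Open Scope group_scope.
Local Notation pc := (product_of_commutators N).
Local Notation inverses l := [seq x^-1 | x <- l].

(** Equality up to boundedly many commutators, uniformly in [n]: an error invisible to growth
    rates. *)
Let close a b : Prop := exists B, forall n, pc B (a n * (b n)^-1).

Let close_refl a : close a a.
Proof. by exists 0%N => n; rewrite mulgV; exact: product_of_commutators1. Qed.

Let close_sym a b : close a b -> close b a.
Proof.
move=> [B aB]; exists B => n.
by have := product_of_commutatorsV (aB n); rewrite invgM invgK.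
Qed.

Let close_trans b a c : close a b -> close b c -> close a c.
Proof.
move=> [B aB] [C bC]; exists (B + C)%N => n.
by have := product_of_commutatorsM (aB n) (bC n); rewrite mulgA mulgVK.
Qed.

Let closeM a b c d : close a b -> close c d ->
  close (fun n => a n * c n) (fun n => b n * d n).
Proof.
move=> [B aB] [C cC]; exists (C + B)%N => n.
have := product_of_commutatorsM (product_of_commutatorsJ (a n) (cC n)) (aB n).
by rewrite invgM !mulgA mulgVK.
Qed.

Let close_comm a b : (forall n, b n \in N) ->
  close (fun n => a n * b n) (fun n => b n * a n).
Proof.
move=> bN; exists 1%N => n.
by rewrite invgM mulgA; exact: product_of_commutators_commutator.
Qed.

Let power_product l n := \prod_(x <- l) x ^+ n.

Let power_product_cat l l' n :
  power_product (l ++ l') n = power_product l n * power_product l' n.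
Proof. exact: big_cat. Qed.

Let power_product1 x n : power_product [:: x] n = x ^+ n.
Proof. exact: big_seq1. Qed.

Let power_product_nseq m x n : power_product (nseq m x) n = x ^+ (n * m).
Proof.
elim: m => [|m IH]; first by rewrite muln0 /power_product big_nil.
by rewrite /power_product big_cons -/(power_product _ _) IH mulnS expgnDr.
Qed.

(** Moving [x ^+ n] past the powers before it costs one commutator whatever [n] is, since [x] lies
    in [N]. *)
Let close_perm l l' : {subset l <= N} -> perm_eq l l' ->
  close (power_product l) (power_product l').
Proof.
elim: l l' => [|x l IH] l' lN.
  by rewrite perm_sym => /perm_nilP ->; exact: close_refl.
move=> ll'; have xl' : x \in l' by rewrite -(perm_mem ll') inE eqxx.
case/splitPr: xl' ll' => l1 l2.
rewrite perm_sym -cat1s perm_catCA /= perm_cons perm_sym => ll.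
have lN' : {subset l <= N} by move=> y yl; apply: lN; rewrite inE yl orbT.
have xN : x \in N by apply: lN; rewrite inE eqxx.
have E1 : power_product (x :: l) = (fun n => x ^+ n * power_product l n).
  by apply/funext => n; rewrite /power_product big_cons.
have E2 : power_product (l1 ++ [:: x] ++ l2) =
    (fun n => power_product l1 n * x ^+ n * power_product l2 n).
  by apply/funext => n; rewrite !power_product_cat power_product1 mulgA.
rewrite E1 E2.
apply: (@close_trans (fun n => x ^+ n * power_product l1 n * power_product l2 n)).
  have -> : (fun n => x ^+ n * power_product l1 n * power_product l2 n) =
      (fun n => x ^+ n * power_product (l1 ++ l2) n).
    by apply/funext => n; rewrite power_product_cat mulgA.
  by apply: closeM; [exact: close_refl|exact: IH].
apply: closeM; last exact: close_refl.
by apply/close_sym/close_comm => n; exact: gpredXn.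
Qed.

(** Inversion reverses the order of the factors, which [close_perm] restores. *)
Let closeV l : {subset l <= N} ->
  close (fun n => (power_product l n)^-1) (power_product (inverses l)).
Proof.
move=> lN; apply: (@close_trans (power_product (rev (inverses l)))).
  have -> : (fun n => (power_product l n)^-1) = power_product (rev (inverses l)).
    apply/funext => n; rewrite /power_product -map_rev big_map.
    by under eq_bigr do rewrite expVgn; rewrite prodgV revK.
  exact: close_refl.
apply: close_perm; last by rewrite perm_rev.
by move=> y; rewrite mem_rev => /mapP[x /lN xN ->]; rewrite gpredV.
Qed.

(** A linear upper bound rather than a limit, so that rates add under concatenation and a list whose
    power products leave [[G, N]] simply has no rate. *)
Let grows l (r : R) : Prop := exists B : nat, forall n, exists2 k,
  pc k (power_product l n) & (k%:R <= n%:R * r + B%:R)%R.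

Let grows_close l l' r : close (power_product l') (power_product l) ->
  grows l r -> grows l' r.
Proof.
move=> [B lB] [C lC]; exists (B + C)%N => n; have [k lk kle] := lC n.
exists (B + k)%N; last by rewrite !natrD; lra.
by have := product_of_commutatorsM (lB n) lk; rewrite mulgVK.
Qed.

Let grows_ext l l' r : power_product l' =1 power_product l ->
  grows l r -> grows l' r.
Proof. by move=> /funext E; apply: grows_close; rewrite E; exact: close_refl. Qed.

Let grows_perm l l' r : {subset l' <= N} -> perm_eq l' l -> grows l r -> grows l' r.
Proof. by move=> lN ll; apply: grows_close; exact: close_perm. Qed.

Let grows_cat l l' r s : grows l r -> grows l' s -> grows (l ++ l') (r + s).
Proof.
move=> [B lB] [C lC]; exists (B + C)%N => n.
have [j lj jle] := lB n; have [k lk kle] := lC n; exists (j + k)%N.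
  by rewrite power_product_cat; exact: product_of_commutatorsM.
by rewrite !natrD; lra.
Qed.

Let grows_inv l r : {subset l <= N} -> grows l r -> grows (inverses l) r.
Proof.
move=> lN [C lC]; have [B lB] := close_sym (closeV lN).
exists (B + C)%N => n; have [k lk kle] := lC n.
exists (B + k)%N; last by rewrite !natrD; lra.
by have := product_of_commutatorsM (lB n) (product_of_commutatorsV lk); rewrite mulgVK.
Qed.

Let grows_trivial l : (forall n, power_product l n = 1) -> grows l 0.
Proof.
move=> l1; exists 0%N => n; exists 0%N; last by rewrite mulr0 addr0.
by rewrite l1; exact: product_of_commutators1.
Qed.

Lemma mul_powers_product (x y : G) n : x \in N -> y \in N ->
  pc n./2 (x ^+ n * y ^+ n * (x * y) ^- n).
Proof.
move=> xN yN; elim/ltn_ind: n => -[|[|n]] IH.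
- by rewrite !expg0 !mulg1 mulgV; exact: product_of_commutators1.
- by rewrite !expg1 mulgV; exact: product_of_commutators1.
rewrite mul_powers_commutator.
set c := commutator _ _; have c1 : pc 1 c.
  apply: product_of_commutators_commutator.
  by rewrite -[_ ^- n]expVgn !(gpredM, gpredXn, gpredV).
move: c c1 => c c1; rewrite -[n.+2]addn2 expgnDr invgM addn2 /= -add1n.
move: ((x * y) ^+ 2) => z; rewrite mulgA [c * (_ * z)]mulgA mulgK -mulgA.
exact: product_of_commutatorsM c1 (IH n _).
Qed.

Section Duality.
Variables (x0 : G) (k0 : nat).
Hypothesis x0k : pc k0 x0.

Let x0N : x0 \in N. Proof. exact: product_of_commutators_mem x0k. Qed.

Let grows_x0 m : grows (nseq m x0) (m * k0)%:R.
Proof.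
exists 0%N => n; exists (n * (m * k0))%N; last by rewrite natrM addr0.
by rewrite power_product_nseq mulnA; exact: product_of_commutatorsX.
Qed.

(** The condition [\sum_(x <- l) f x <= \sum_(x <- l') f x + r] is imposed on [f]
    when the mixed commutator length of the products of [n]-th powers grows at
    speed at most [r]; the copies of [x0] build in [scl x0 <= f x0]. *)
Let constraint l l' (r : R) : Prop := [/\ {subset l <= N}, {subset l' <= N} &
  exists m, grows (l ++ inverses l' ++ nseq m x0) (r + m%:R * scl R N x0)].

Let subset_inverses l : {subset l <= N} -> {subset inverses l <= N}.
Proof. by move=> lN _ /mapP[x /lN xN ->]; rewrite gpredV. Qed.

Let subset_cat l l' : {subset l <= N} -> {subset l' <= N} -> {subset l ++ l' <= N}.
Proof. by move=> lN l'N x; rewrite mem_cat => /orP[/lN|/l'N]. Qed.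

Let subset_nseq m x : x \in N -> {subset nseq m x <= N}.
Proof. by move=> xN y /nseqP[->]. Qed.

Let subset_seq1 x : x \in N -> {subset [:: x] <= N}.
Proof. exact: (@subset_nseq 1). Qed.

Let inverses_nseq m (x : G) : inverses (nseq m x) = nseq m x^-1.
Proof. exact: map_nseq. Qed.

Let power_product_inv_nseq m x n :
  power_product (nseq m x) n * power_product (nseq m x^-1) n = 1.
Proof. by rewrite !power_product_nseq expVgn mulgV. Qed.

Let constraint_cat l l' r m m' s :
  constraint l l' r -> constraint m m' s -> constraint (l ++ m) (l' ++ m') (r + s).
Proof.
move=> [lN l'N [a la]] [mN m'N [b mb]]; split; [exact: subset_cat..|].
exists (a + b)%N; have := grows_cat la mb.
have -> : (r + a%:R * scl R N x0 + (s + b%:R * scl R N x0) =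
   r + s + (a + b)%:R * scl R N x0)%R by rewrite natrD; ring.
apply: grows_perm.
  rewrite map_cat; do !apply: subset_cat => //; try exact: subset_inverses.
  exact: subset_nseq.
by apply/permP => p; rewrite map_cat nseqD !count_cat; lia.
Qed.

Let constraint_sym l l' r : constraint l l' r -> exists s, constraint l' l s.
Proof.
move=> [lN l'N [m la]].
have llN : {subset l ++ inverses l' ++ nseq m x0 <= N}.
  by do !apply: subset_cat => //; [exact: subset_inverses|exact: subset_nseq].
(* The inverted list carries [m] copies of [x0^-1]; adding [m + m] copies of [x0] leaves the [m]
   copies required. *)
have := grows_cat (grows_inv llN la) (grows_x0 (m + m)).
set s := (X in grows _ X) => ls; exists (s - m%:R * scl R N x0)%R.
split=> //; exists m; rewrite subrK.
have E : power_product (l' ++ inverses l ++ nseq m x0) =1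
    power_product ((l' ++ inverses l) ++ nseq m x0 ++ nseq m x0^-1 ++ nseq m x0).
  move=> n; rewrite !catA !power_product_cat.
  by rewrite -[_ * _ * power_product (nseq m x0^-1) n]mulgA power_product_inv_nseq mulg1.
apply: (grows_ext E); apply: grows_perm ls.
  have Vx0N : x0^-1 \in N by rewrite gpredV.
  by do !apply: subset_cat => //; [exact: subset_inverses|exact: subset_nseq..].
apply/permP => p; rewrite !map_cat (mapK (@invgK G)) inverses_nseq nseqD.
by rewrite !count_cat; lia.
Qed.

(** The contributions of [l] and [inverses l'] cancel up to [close], leaving [x0 ^+ (n * m)], of
    length at least [n * m] times [scl x0]. Against the rate [r + m * scl x0], this bounds [- n * r]
    from above. *)
Let constraint_perm l l' r : constraint l l' r -> perm_eq l l' -> (0 <= r)%R.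
Proof.
move=> [lN l'N [m la]] ll'.
have [B trivB] : close (fun n => power_product l n * (power_product l n)^-1 *
      power_product (nseq m x0) n)
    (fun n => power_product l n * power_product (inverses l') n *
      power_product (nseq m x0) n).
  apply: closeM; last exact: close_refl.
  apply: closeM; first exact: close_refl.
  apply: (close_trans (closeV lN)); apply: close_perm; last exact: perm_map.
  exact: subset_inverses.
have [C lC] := la.
rewrite -oppr_le0; apply: (@le0_of_mulrn_bounded _ _ (B + C)%:R) => n.
have [k lk kle] := lC n.
have := trivB n; rewrite mulgV mul1g -mulgA -!power_product_cat.
move=> /product_of_commutatorsM/(_ lk); rewrite mulgVK power_product_nseq => /cl_spec[_].
rewrite -(ler_nat R) => cl_le.
have := le_trans (scl_le_cl R x0k (n * m)) cl_le.
by rewrite natrM !natrD mulrN; move: kle; lra.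
Qed.

Let constraint_of_grows l l' r : {subset l <= N} -> {subset l' <= N} ->
  grows (l ++ inverses l') r -> constraint l l' r.
Proof. by move=> lN l'N ll'; split=> //; exists 0%N; rewrite cats0 mul0r addr0. Qed.

(** A zero rate survives inversion, so the constraint holds in both directions. *)
Let constraint_eq l l' (f : G -> R) : {subset l <= N} -> {subset l' <= N} ->
  (forall l l' r, constraint l l' r ->
    (\sum_(x <- l) f x <= \sum_(x <- l') f x + r)%R) ->
  grows (l ++ inverses l') 0 -> (\sum_(x <- l) f x = \sum_(x <- l') f x)%R.
Proof.
move=> lN l'N fC ll'; apply/eqP; rewrite eq_le.
have := fC _ _ _ (constraint_of_grows lN l'N ll'); rewrite addr0 => ->.
have llN : {subset l ++ inverses l' <= N}.
  by apply: subset_cat => //; exact: subset_inverses.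
rewrite -[leRHS]addr0; apply/fC/constraint_of_grows => //.
apply: grows_perm (grows_inv llN ll').
  by apply: subset_cat => //; exact: subset_inverses.
apply/permP => p; by rewrite map_cat (mapK (@invgK G)) !count_cat addnC.
Qed.

Theorem invariant_qm_ge_scl :
  exists2 f : G -> R, invariant_qm_on N 2^-1 f & (scl R N x0 <= f x0)%R.
Proof.
have [||||f fC] := @hahn_banach_seq R G constraint.
- by apply: constraint_of_grows => //; apply: grows_trivial => n; exact: big_nil.
- exact: constraint_cat.
- exact: constraint_sym.
- exact: constraint_perm.
exists f; last first.
  (* Taken with [m = 1]: the product of [x0 ^- n] and [x0 ^+ n] is trivial, and its rate [0] is
     [- scl x0 + scl x0]. *)
  rewrite -subr_le0; suff /fC : constraint [::] [:: x0] (- scl R N x0)%R.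
    by rewrite big_nil big_seq1 subr_ge0 subr_le0.
  split=> //; first exact: subset_seq1.
  exists 1%N; rewrite mul1r addNr; apply: grows_trivial => n.
  by rewrite /power_product big_cons big_seq1 expVgn mulVg.
have defect x y : x \in N -> y \in N ->
    grows ([:: x; y] ++ inverses [:: x * y]) 2^-1.
  move=> xN yN; exists 0%N => n; exists n./2.
    rewrite /power_product !big_cons big_nil mulg1 mulgA expVgn.
    exact: mul_powers_product.
  rewrite addr0 ler_pdivlMr// -natrM ler_nat muln2.
  by rewrite -[leqRHS]odd_double_half leq_addl.
have xy_sub x y : x \in N -> y \in N -> {subset [:: x; y] <= N}.
  by move=> xN yN z; rewrite !inE => /orP[] /eqP->.
split=> [x y /= xN yN|x n xN|g x xN].
- have xyN : x * y \in N by exact: gpredM.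
  have := fC _ _ _ (constraint_of_grows (xy_sub _ _ xN yN) (subset_seq1 xyN)
    (defect _ _ xN yN)).
  rewrite !big_cons !big_nil !addr0 => le1.
  suff /fC : constraint [:: x * y] [:: x; y] 2^-1.
    rewrite !big_cons !big_nil !addr0 => le2.
    by rewrite ler_norml; apply/andP; split; lra.
  apply: constraint_of_grows; [exact: subset_seq1|exact: xy_sub|].
  have sub3 : {subset [:: x; y] ++ inverses [:: x * y] <= N}.
    by apply: subset_cat; [exact: xy_sub|apply: subset_inverses; exact: subset_seq1].
  apply: grows_perm (grows_inv sub3 (defect _ _ xN yN)).
    by apply: subset_cat; [exact: subset_seq1|apply: subset_inverses; exact: xy_sub].
  by apply/permP => p; rewrite /= invgK; lia.
- have xnN : x ^+ n \in N by exact: gpredXn.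
  have := constraint_eq (subset_seq1 xnN) (@subset_nseq n _ xN) fC.
  rewrite big_seq1 big_nseq iter_addr_0 mulr_natl; apply.
  apply: grows_trivial => m; rewrite power_product_cat power_product1.
  by rewrite inverses_nseq power_product_nseq expVgn -expgnA mulnC mulgV.
- have gxN : g * x * g^-1 \in N by exact: gpred_conj.
  have := constraint_eq (subset_seq1 gxN) (subset_seq1 xN) fC.
  rewrite !big_seq1; apply.
  exists 1%N => n; exists 1%N; last by rewrite mulr0 add0r.
  rewrite power_product_cat !power_product1 expVgn.
  have -> : (g * x * g^-1) ^+ n = g * x ^+ n * g^-1.
    by have := conjXg x g^-1 n; rewrite !conjgE invgK !mulgA => <-.
  exact/product_of_commutators_commutator/gpredXn.
Qed.

End Duality.

End BavardDuality.

(** * Defects of homogeneous quasimorphisms *)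

Section Homogeneous.
Variable R : realType.
Local Open Scope ring_scope.

(** The values at [x ^- n] and [x ^+ n] have a sum bounded by the defect, yet linear in [n]. *)
Lemma powers_inv (G : groupType) (H : set G) (D : R) (f : G -> R) (x : G) :
  defect_on H D f -> (forall n, H (x ^+ n)%g) -> (forall n, H (x ^- n)%g) ->
  (forall y n, H y -> f (y ^+ n)%g = n%:R * f y) -> f x^-1%g = - f x.
Proof.
move=> fD Hx HxV fX.
have f1 : f 1%g = 0 by have := fX _ 0%N (Hx 0%N); rewrite !expg0 mul0r.
apply/eqP; rewrite -addr_eq0; apply/eqP.
apply: (@eq0_of_mulrn_bounded _ _ D) => n.
have := fD _ _ (HxV n) (Hx n); rewrite mulVg f1 -expVgn.
rewrite (fX x^-1%g) ?(fX x); [|exact: (Hx 1%N)|exact: (HxV 1%N)].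
by rewrite sub0r -opprD normrN -mulrDr normrM normr_nat.
Qed.

Lemma homogeneous_of_powers (H : groupType) (D : R) (f : H -> R) :
  defect_on [set: H] D f ->
  (forall x n, f (x ^+ n)%g = n%:R * f x) -> homogeneous f.
Proof.
move=> fD fX x.
have fV y : f y^-1%g = - f y by apply: powers_inv fD _ _ _ => // z n _; exact: fX.
by case=> n /=; [rewrite fX|rewrite fV fX NegzE mulNr; congr (- (_ * _))].
Qed.

Section Group.
Variables (G : groupType) (D : R) (f : G -> R).
Hypotheses (fD : defect_on [set: G] D f) (fh : homogeneous f).

Lemma homogeneousX x n : f (x ^+ n)%g = n%:R * f x.
Proof. by have := fh x n%:Z. Qed.

Lemma homogeneous1 : f 1%g = 0.
Proof. by have := homogeneousX 1%g 0; rewrite expg0 mul0r. Qed.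

Lemma homogeneousV x : f x^-1%g = - f x.
Proof. by have := fh x (-1); rewrite /= expg1 mulN1r. Qed.

(** Conjugation changes the value at every power of [x] by at most [D + D], hence not at all. *)
Lemma homogeneousJ g x : f (g * x * g^-1)%g = f x.
Proof.
apply/eqP; rewrite -subr_eq0; apply/eqP.
apply: (@eq0_of_mulrn_bounded _ _ (D + D)) => n.
have -> : n%:R * `|f (g * x * g^-1)%g - f x| =
    `|f (g * x ^+ n * g^-1)%g - f (x ^+ n)%g|.
  have -> : (g * x ^+ n * g^-1 = (g * x * g^-1) ^+ n)%g.
    by have := conjXg x g^-1%g n; rewrite !conjgE invgK !mulgA => <-.
  by rewrite !homogeneousX -mulrBr normrM normr_nat.
have := @fD (g * x ^+ n)%g g^-1%g I I; have := @fD g (x ^+ n)%g I I.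
rewrite homogeneousV !ler_norml => /andP[? ?] /andP[? ?]; apply/andP; split; lra.
Qed.

(** A commutator is a conjugate of [v] times [v^-1], and their values cancel. *)
Lemma homogeneous_commutator u v : `|f (commutator u v)| <= D.
Proof.
have := @fD (u * v * u^-1)%g v^-1%g I I.
by rewrite homogeneousJ homogeneousV opprK subrK.
Qed.

End Group.

Section Scl.
Variables (G : groupType) (N : {pred G}) (f : G -> R) (c : R) (x : G) (k : nat).

(** Here [c] is the cost of one commutator, so [|f (x ^+ n)|] is at most [c * cl (x ^+ n)]; divide
    by [n]. *)
Lemma norm_le_scl : f 1%g = 0 -> 0 <= c ->
  (forall j g y z, y \in N -> product_of_commutators N j z ->
    `|f (commutator g y * z)%g - f z| <= c) ->
  (forall n, f (x ^+ n)%g = n%:R * f x) ->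
  product_of_commutators N k x -> `|f x| <= c * scl R N x.
Proof.
move=> f1 c0 fc fX xk.
have f_le j y : product_of_commutators N j y -> `|f y| <= c * j%:R.
  move: j y; apply: product_of_commutators_ind => [|j g y z yN zj IH].
    by rewrite f1 normr0 mulr0.
  have := fc j g y z yN zj; rewrite -natr1 mulrDr mulr1 => fcyz.
  have := ler_normD (f (commutator g y * z)%g - f z) (f z); rewrite subrK; lra.
have fx_le n : n%:R * `|f x| <= c * (cl N (x ^+ n)%g)%:R.
  have [xn _] := cl_spec (product_of_commutatorsX n xk).
  by have := f_le _ _ xn; rewrite fX normrM normr_nat.
have [c_gt0|] := ltP 0 c; last first.
  move=> /(conj c0)/andP/le_anti c_eq0; rewrite -c_eq0 mul0r.
  by have := fx_le 1%N; rewrite -c_eq0 mul0r mul1r.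
rewrite mulrC -ler_pdivrMr//; apply: (scl_ge xk) => n.
by rewrite mulrA ler_pdivrMr// [leRHS]mulrC.
Qed.

End Scl.

(** A commutator costs [2 * D]: [D] for its value and [D] for multiplying by it. *)
Lemma homogeneous_le_scl (G : groupType) (D : R) (f : G -> R) k x :
  defect_on [set: G] D f -> homogeneous f ->
  product_of_commutators predT k x -> `|f x| <= 2 * D * scl R predT x.
Proof.
move=> fD fh; apply: norm_le_scl; first exact: homogeneous1.
- by rewrite mulr_ge0// (le_trans _ (fD 1%g 1%g I I)).
- move=> j g y z _ _; have := homogeneous_commutator fD fh g y.
  have := fD (commutator g y) z I I.
  by rewrite !ler_norml => /andP[? ?] /andP[? ?]; apply/andP; split; lra.
- exact: homogeneousX.
Qed.

Lemma invariant_qm_le_scl (G : groupType) (N : normalSubgroup G) (D : R)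
    (f : G -> R) k x :
  invariant_qm_on N D f -> product_of_commutators N k x ->
  `|f x| <= 2 * D * scl R N x.
Proof.
move=> [fD fX fJ] xk; have N1 : 1%g \in N by exact: gpred1.
apply: (norm_le_scl _ _ _ _ xk).
- by have := fX _ 0%N N1; rewrite expg0 mul0r.
- by rewrite mulr_ge0// (le_trans _ (fD 1%g 1%g N1 N1)).
- move=> j g y z yN /product_of_commutators_mem zN.
  have gyN : (g * y * g^-1)%g \in N by exact: gpred_conj.
  have yVN : (y^-1)%g \in N by rewrite gpredV.
  have fV : f y^-1%g = - f y.
    apply: powers_inv fD _ _ fX => n /=; first exact: gpredXn.
    exact: gpredXNn.
  have := fD _ _ gyN yVN; rewrite fJ// fV opprK subrK => fc.
  have /fD/(_ zN) : commutator g y \in N by exact: gpredM.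
  by move: fc; rewrite !ler_norml => /andP[? ?] /andP[? ?]; apply/andP; split; lra.
- by move=> n; apply/fX; exact: product_of_commutators_mem xk.
Qed.

Definition is_subgroup (G : groupType) (H : set G) : Prop :=
  [/\ H 1%g, forall x y, H x -> H y -> H (x * y)%g & forall x, H x -> H x^-1%g].

Lemma is_subgroupX (G : groupType) (H : set G) x n : is_subgroup H ->
  H x -> H (x ^+ n)%g.
Proof.
move=> [H1 HM _] Hx; elim: n => [|n IH]; first by rewrite expg0.
by rewrite expgS; exact: HM.
Qed.

(** The factor [1 / 2] arises because [a ^+ n * b ^+ n] is obtained from
    [(a * b) ^+ n] by inserting [n / 2] commutators. *)
Lemma defect_of_commutators (G : groupType) (H : set G) (D B c : R) (f q : G -> R) :
  is_subgroup H -> defect_on H D f ->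
  (forall x n, H x -> f (x ^+ n)%g = n%:R * f x) ->
  (forall x, H x -> `|f x - q x| <= B) ->
  (forall u v w, H u -> H v -> H w -> `|q (commutator u v * w)%g - q w| <= c) ->
  defect_on H (c / 2) f.
Proof.
move=> Hgrp fD fX fq qc a b Ha Hb; have [H1 HM HV] := Hgrp.
have HX y n := @is_subgroupX _ _ y n Hgrp.
have Hab := HM _ _ Ha Hb.
have q_powers n w : H w ->
    `|q (a ^+ n * b ^+ n * w)%g - q ((a * b) ^+ n * w)%g| <= c * (n./2)%:R.
  elim/ltn_ind: n w => -[|[|n]] IH w Hw.
  - by rewrite !expg0 mulg1 subrr normr0 mulr0.
  - by rewrite !expg1 subrr normr0 mulr0.
  have Hab2w : H ((a * b) ^+ 2 * w)%g by apply/HM => //; exact: HX.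
  have := IH n (ltnW (ltnSn _)) _ Hab2w.
  set u := (a ^+ n.+1 * b ^- n * a ^- n)%g.
  set v := (a ^+ n * b ^+ n * a * b * a ^- n)%g.
  have Hu : H u by apply/HM/HV/HX => //; apply/HM/HV/HX => //; exact: HX.
  have Hv : H v.
    by apply/HM/HV/HX => //; do 2![apply: (HM) => //]; apply: HM; exact: HX.
  have -> : (a ^+ n.+2 * b ^+ n.+2 * w =
      commutator u v * (a ^+ n * b ^+ n * ((a * b) ^+ 2 * w)))%g.
    rewrite mul_powers_commutator -/u -/v -mulgA; congr (_ * _)%g.
    exact/esym/mulgA.
  have -> : ((a * b) ^+ n.+2 * w = (a * b) ^+ n * ((a * b) ^+ 2 * w))%g.
    by rewrite -[n.+2]addn2 expgnDr -mulgA.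
  rewrite -[n.+2./2]/(n./2.+1) -natr1 mulrDr mulr1.
  have := qc u v (a ^+ n * b ^+ n * ((a * b) ^+ 2 * w))%g Hu Hv.
  have Hz : H (a ^+ n * b ^+ n * ((a * b) ^+ 2 * w))%g.
    by apply: (HM) => //; apply: (HM); exact: HX.
  move=> /(_ Hz) q1 q2.
  rewrite (le_trans (ler_distD (q (a ^+ n * b ^+ n * ((a * b) ^+ 2 * w))%g) _ _))//.
  by rewrite [leRHS]addrC lerD.
(* [D] splits [f (a ^+ n * b ^+ n)], and each [B] pays for one passage between [f] and [q]. *)
rewrite -subr_le0; apply: (@le0_of_mulrn_bounded _ _ (D + B + B)) => n.
have Han := HX a n Ha; have Hbn := HX b n Hb; have Habn := HX _ n Hab.
have := q_powers n 1%g H1; rewrite !mulg1.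
have := fq _ (HM _ _ Han Hbn); have := fq _ Habn.
have := fD _ _ Han Hbn.
have c_half : c * (n./2)%:R <= n%:R * (c / 2).
  have c0 : 0 <= c by rewrite (le_trans _ (qc 1%g 1%g 1%g H1 H1 H1)).
  rewrite mulrA [leRHS]mulrAC mulrC ler_wpM2r// ler_pdivlMr// -natrM ler_nat.
  by rewrite muln2 -[leqRHS]odd_double_half leq_addl.
have -> : n%:R * (`|f (a * b)%g - f a - f b| - c / 2) =
    `|f ((a * b) ^+ n)%g - f (a ^+ n)%g - f (b ^+ n)%g| - n%:R * (c / 2).
  by rewrite !fX// -!mulrBr normrM normr_nat mulrBr.
set p := f (_ * _)%g; set p' := f _; set p1 := f _; set p2 := f _.
rewrite !ler_norml => /andP[? ?] /andP[? ?] /andP[? ?] /andP[? ?].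
rewrite lerBlDr ler_norml; apply/andP; split; lra.
Qed.

Section Solvable.
Variables (G : groupType) (D : R) (f : G -> R).
Hypotheses (fD : defect_on [set: G] D f) (fh : homogeneous f).

(** A converse to [homogeneous_commutator]: the values on commutators control the defect. Each
    improvement halves the excess over [d]. *)
Lemma defect_of_commutator_values (H : set G) d : is_subgroup H ->
  (forall u v, H u -> H v -> `|f (commutator u v)| <= d) -> defect_on H d f.
Proof.
move=> Hgrp fd; have [H1 HM HV] := Hgrp.
(* A commutator costs at most [d + E], so a defect [E] improves to the midpoint
   of [d] and [E]. *)
have improve E : defect_on H E f -> defect_on H ((d + E) / 2) f.
  move=> fE; apply: (@defect_of_commutators _ _ E 0 _ f f) => //.
  - by move=> x n _; exact: homogeneousX.
  - by move=> x _; rewrite subrr normr0.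
  - move=> u v w Hu Hv Hw; have := fd u v Hu Hv.
    have Huv : H (commutator u v).
      exact: HM _ _ (HM _ _ (HM _ _ Hu Hv) (HV _ Hu)) (HV _ Hv).
    have := fE _ _ Huv Hw.
    by rewrite !ler_norml => /andP[? ?] /andP[? ?]; apply/andP; split; lra.
have improved n : defect_on H (d + (D - d) / 2 ^+ n) f.
  elim: n => [|n /improve IH].
    by rewrite expr0 divr1 addrC subrK => x y _ _; exact: fD.
  suff -> : d + (D - d) / 2 ^+ n.+1 = (d + (d + (D - d) / 2 ^+ n)) / 2 by [].
  by rewrite exprS; field; rewrite expf_neq0.
move=> x y Hx Hy; rewrite leNgt; apply/negP; rewrite -subr_gt0 => e_gt0.
have : `|f (x * y)%g - f x - f y| - d <= 0.
  apply: (@le0_of_mulrn_bounded _ _ (D - d)) => n.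
  have := improved n x y Hx Hy; rewrite -lerBlDl ler_pdivlMr ?exprn_gt0//.
  apply: le_trans; rewrite mulrC ler_wpM2l// ?(ltW e_gt0)//.
  by rewrite -natrX ler_nat ltnW// ltn_expl.
by rewrite leNgt e_gt0.
Qed.

(** [commutator (a ^+ n) b] is a product of [n] conjugates of [commutator a b], so its value is
    [n * f (commutator a b)] up to [n * d]. Being bounded by [D] for all [n], it forces
    [|f (commutator a b)| <= d]. *)
Lemma defect_on_commutators (H K : set G) d : is_subgroup H -> is_subgroup K ->
  (forall u v, H u -> H v -> K (commutator u v)) ->
  defect_on K d f -> defect_on H d f.
Proof.
move=> Hgrp [K1 KM KV] HK fd; apply: defect_of_commutator_values => // a b Ha Hb.
have Kab n : K (commutator (a ^+ n)%g b) by apply: HK => //; exact: is_subgroupX.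
have step n : (commutator (a ^+ n.+1) b =
    a * commutator (a ^+ n) b * a^-1 * commutator a b)%g.
  by rewrite /commutator expgS !(invgM, mulgA, mulgVK).
(* To be compared with the boundedness in [n] of [f (commutator (a ^+ n) b)]. *)
have near_n n : `|f (commutator (a ^+ n)%g b) - n%:R * f (commutator a b)| <= n%:R * d.
  elim: n => [|n IH].
    rewrite expg0 /commutator mul1g invg1 mulg1 mulgV homogeneous1//.
    by rewrite !mul0r subrr normr0.
  (* [K] need not be normal; membership of the conjugate is read off from [step]. *)
  have Kconj : K (a * commutator (a ^+ n) b * a^-1)%g.
    have -> : (a * commutator (a ^+ n) b * a^-1 =
        commutator (a ^+ n.+1) b * (commutator a b)^-1)%g by rewrite step mulgK.
    by apply: KM => //; apply: KV; have := Kab 1%N; rewrite expg1.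
  have := fd _ _ Kconj; have := Kab 1%N; rewrite expg1 => K1ab /(_ _ K1ab).
  rewrite -step (homogeneousJ fD fh) -!natr1 !mulrDl !mul1r; move: IH.
  by rewrite !ler_norml => /andP[? ?] /andP[? ?]; apply/andP; split; lra.
rewrite -subr_le0; apply: (@le0_of_mulrn_bounded _ _ D) => n.
have -> : n%:R * (`|f (commutator a b)| - d) =
    `|n%:R * f (commutator a b)| - n%:R * d by rewrite mulrBr normrM normr_nat.
rewrite lerBlDr.
have := homogeneous_commutator fD fh (a ^+ n)%g b; have := near_n n.
by rewrite !ler_norml => /andP[? ?] /andP[? ?]; apply/andP; split; lra.
Qed.

End Solvable.

End Homogeneous.

(** * Lifting defect bounds through a solvable or amenable quotient *)

Section Quotient.
Variables (R : realType) (G : groupType) (N : normalSubgroup G).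
Variables (D : R) (f : G -> R).
Hypotheses (fD : defect_on [set: G] D f) (fh : homogeneous f).
Local Open Scope ring_scope.

Let preimage_derived n : set G :=
  [set x | derived_subgroup n (coset_class N x)].

Let coset_class_mul x y :
  coset_class N (x * y)%g = (coset_class N x * coset_class N y)%g.
Proof. exact/esym/coset_classM. Qed.

Let coset_class_inv x : coset_class N x^-1%g = (coset_class N x)^-1%g.
Proof. exact/esym/coset_classV. Qed.

Lemma is_subgroup_generated (H : groupType) (A : set H) : is_subgroup (generated A).
Proof.
have closedP (B : set H) : group_closed (fun x => x \in B) -> is_subgroup B.
  move=> Bgrp; split.
  - exact/set_mem/Bgrp.1.
  - by move=> x y /mem_set xB /mem_set yB; apply/set_mem/(group_closedM Bgrp).
  - by move=> x /mem_set xB; apply/set_mem/(group_closedV Bgrp).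
split=> [B [/closedP[]//]|x y Ax Ay B BA|x Ax B BA].
- have [_ BM _] := closedP _ BA.1; apply: BM; [exact: Ax|exact: Ay].
- have [_ _ BV] := closedP _ BA.1; apply: BV; exact: Ax.
Qed.

Lemma is_subgroup_derived (H : groupType) n : is_subgroup (@derived_subgroup H n).
Proof. by case: n => [|n]; [split|exact: is_subgroup_generated]. Qed.

Let is_subgroup_preimage n : is_subgroup (preimage_derived n).
Proof.
have [H1 HM HV] := is_subgroup_derived (quotient_group N) n.
split=> [|x y Hx Hy|x Hx]; rewrite /preimage_derived /=.
- exact: H1.
- by rewrite coset_class_mul; exact: HM.
- by rewrite coset_class_inv; exact: HV.
Qed.

(** The preimages of the derived series climb from [N] to [G], and commutators of each lie in the
    one below, so [defect_on_commutators] carries the bound [d] upwards. *)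
Lemma defect_solvable d : solvable_group (quotient_group N) ->
  defect_on [set` N] d f -> defect_on [set: G] d f.
Proof.
move=> [n derived_n] fd.
suff lift_defect m : defect_on (preimage_derived (n - m)) d f.
  by have := lift_defect n; rewrite subnn.
elim: m => [|m IH].
  move=> x y; rewrite subn0 /preimage_derived /= derived_n => xN yN.
  have mem_ker z : coset_class N z = 1%g -> z \in N.
    by move=> /esym/coset_classP; rewrite invg1 mul1g.
  by apply: fd; exact: mem_ker.
(* Once [n <= m], truncated subtraction has already reached [0], the whole group. *)
have [mn|nm] := ltnP m n; last first.
  by rewrite (_ : (n - m.+1 = n - m)%N)//; lia.
apply: (defect_on_commutators fD fh) IH; [exact: is_subgroup_preimage..|].
move=> u v Hu Hv; rewrite -[(n - m)%N]prednK ?subn_gt0// -subnS.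
apply: sub_gen_smallest; exists (coset_class N u) => //.
exists (coset_class N v) => //.
by rewrite /commutator !coset_class_mul !coset_class_inv.
Qed.

Section Amenable.
Variable d : R.
Hypothesis fd : defect_on [set` N] d f.

Let section (a : quotient_group N) : G := repr a.
Let translate g a := section (coset_class N g * a)%g.
(** The Schreier cocycle: [g * section a = translate g a * cocycle g a]. *)
Let cocycle g a := ((translate g a)^-1 * g * section a)%g.

Let cocycle_mem g a : cocycle g a \in N.
Proof.
rewrite /cocycle -mulgA; apply/coset_classP.
by rewrite /translate /section coset_class_mul /coset_class !reprK.
Qed.

Let coset_action g h a : (coset_class N (g * h) * a =
  coset_class N g * (coset_class N h * a))%g.
Proof. by rewrite coset_class_mul mulgA. Qed.

Let cocycleM g h a :
  cocycle (g * h)%g a = (cocycle g (coset_class N h * a) * cocycle h a)%g.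
Proof.
by rewrite /cocycle /translate coset_action !mulgA mulgK.
Qed.

(** The first term lives on [N], where the defect is [d]; the other two form a coboundary, which
    keeps the sum near [f g] and telescopes in [perturbedM]. *)
Let perturbed g a := f (cocycle g a) + f (translate g a) - f (section a).

Let perturbed_near g a : `|perturbed g a - f g| <= D + D.
Proof.
have E : g = (translate g a * cocycle g a * (section a)^-1)%g.
  by rewrite /cocycle !mulgA mulgV mul1g mulgK.
have := @fD (translate g a * cocycle g a)%g (section a)^-1%g I I.
have := @fD (translate g a) (cocycle g a) I I.
rewrite -E (homogeneousV fh) /perturbed.
by rewrite !ler_norml => /andP[? ?] /andP[? ?]; apply/andP; split; lra.
Qed.

Let perturbedM g h a :
  `|perturbed (g * h)%g a - perturbed g (coset_class N h * a)%g - perturbed h a| <= d.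
Proof.
have := fd (cocycle_mem g (coset_class N h * a)%g) (cocycle_mem h a).
rewrite -cocycleM /perturbed /translate coset_action.
by rewrite !ler_norml => /andP[? ?]; apply/andP; split; lra.
Qed.

(** Averaging [perturbed] over [a] by the mean removes the shift by [h] in [perturbedM], giving a
    function near [f] of defect [d] on all of [G]. *)
Lemma defect_amenable : amenable R (quotient_group N) ->
  defect_on [set: G] (2 * d) f.
Proof.
case=> m [mD mZ m_ge0 m1 m_inv].
pose bounded (h : quotient_group N -> R) := exists C, forall a, `|h a| <= C.
have bounded_cst c : bounded (fun=> c) by exists `|c|.
have boundedD h h' : bounded h -> bounded h' -> bounded (h \+ h').
  move=> [B hB] [C hC]; exists (B + C) => a.
  by rewrite (le_trans (ler_normD _ _))// lerD.
have boundedN h : bounded h -> bounded (fun a => - h a).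
  by move=> [C hC]; exists C => a; rewrite normrN.
have mN h : bounded h -> m (fun a => - h a) = - m h.
  by move=> hb; under eq_fun do rewrite -mulN1r; rewrite mZ// mulN1r.
have m_cst c : m (fun=> c) = c.
  have -> : (fun=> c) = (fun a : quotient_group N => c * 1).
    by apply/funext => a; rewrite mulr1.
  by rewrite mZ; [rewrite m1 mulr1|exact: bounded_cst].
have m_le h c : bounded h -> (forall a, h a <= c) -> m h <= c.
  move=> hb hc; rewrite -subr_ge0 -[X in X - _](m_cst c) -mN//.
  have Nhb := boundedN _ hb; have cb := bounded_cst c.
  rewrite -mD//; apply: m_ge0 => [|a]; first exact: boundedD.
  by rewrite /= subr_ge0.
have m_norm h c : bounded h -> (forall a, `|h a| <= c) -> `|m h| <= c.
  move=> hb hc; rewrite ler_norml; apply/andP; split.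
    rewrite lerNl -mN//; apply: m_le => [|a]; first exact: boundedN.
    by rewrite (le_trans _ (hc a))// -normrN ler_norm.
  by apply: m_le => // a; rewrite (le_trans (ler_norm _)).
have perturbed_bounded g : bounded (perturbed g).
  exists (D + D + `|f g|) => a; rewrite -lerBlDr.
  rewrite (le_trans _ (perturbed_near g a))// (le_trans _ (ler_dist_dist _ _))//.
  exact: ler_norm.
have perturbed_shift g h : bounded (fun a => perturbed g (coset_class N h * a)%g).
  by have [C pC] := perturbed_bounded g; exists C.
pose F g := m (perturbed g).
have F_near g : `|F g - f g| <= D + D.
  have gb := perturbed_bounded g; have cb := bounded_cst (f g); have Ncb := boundedN _ cb.
  rewrite -(m_cst (f g)) -mN// -mD//.
  apply: m_norm => [|a]; first exact: boundedD.
  exact: perturbed_near.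
have FM : forall g h, `|F (g * h)%g - F g - F h| <= d.
  move=> g h; have gb := perturbed_bounded g; have hb := perturbed_bounded h.
  have ghb := perturbed_bounded (g * h)%g; have sb := perturbed_shift g h.
  have Nsb := boundedN _ sb; have Nhb := boundedN _ hb.
  have gsb := boundedD _ _ ghb Nsb.
  rewrite /F -(m_inv (coset_class N h) (perturbed g))// -!mN//.
  rewrite -mD// -mD//; apply: m_norm => [|a]; first exact: boundedD.
  exact: perturbedM.
(* Making the average odd is what brings the cost of a commutator down to
   [4 * d]. *)
pose q x := (F x - F x^-1%g) / 2.
have qV x : q x^-1%g = - q x by rewrite /q invgK -mulNr opprB.
have qM : forall g h, `|q (g * h)%g - q g - q h| <= d.
  move=> g h; have := FM g h; have := FM h^-1%g g^-1%g; rewrite /q invgM.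
  by rewrite !ler_norml => /andP[? ?] /andP[? ?]; apply/andP; split; lra.
have q_near g : `|f g - q g| <= D + D.
  have := F_near g; have := F_near g^-1%g; rewrite /q (homogeneousV fh).
  by rewrite !ler_norml => /andP[? ?] /andP[? ?]; apply/andP; split; lra.
have -> : 2 * d = 4 * d / 2 by field.
apply: (@defect_of_commutators _ _ _ D (D + D) _ f q) => //.
- by move=> x n _; exact: homogeneousX.
- move=> u v w _ _ _.
  have := qM u (v * u^-1 * v^-1 * w)%g; have := qM v (u^-1 * v^-1 * w)%g.
  have := qM u^-1%g (v^-1 * w)%g; have := qM v^-1%g w.
  rewrite !qV /commutator !mulgA.
  rewrite !ler_norml => /andP[? ?] /andP[? ?] /andP[? ?] /andP[? ?].
  by apply/andP; split; lra.
Qed.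

End Amenable.

End Quotient.

(** * Extension to the ambient group *)

Section Decomposition.
Variables (R : realType) (G : groupType) (N : normalSubgroup G).
Local Open Scope ring_scope.

Lemma invariant_qm_on_combination (D E a : R) (f g : G -> R) : 0 <= a ->
  invariant_qm_on N D f -> invariant_qm_on N E g ->
  invariant_qm_on N (D + a * E) (fun x => f x + a * g x).
Proof.
move=> a0 [fD fX fJ] [gE gX gJ]; split.
- move=> x y Nx Ny.
  have -> : f (x * y)%g + a * g (x * y)%g - (f x + a * g x) - (f y + a * g y) =
    (f (x * y)%g - f x - f y) + a * (g (x * y)%g - g x - g y) by ring.
  rewrite (le_trans (ler_normD _ _))// lerD ?fD// normrM ger0_norm//.
  by rewrite ler_wpM2l// gE.
- by move=> x n xN; rewrite fX// gX//; ring.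
- by move=> g' x xN; rewrite fJ// gJ.
Qed.

Lemma invariant_qm_on_le (D E : R) (f : G -> R) : D <= E ->
  invariant_qm_on N D f -> invariant_qm_on N E f.
Proof.
by move=> DE [fD fX fJ]; split=> // x y Nx Ny; rewrite (le_trans (fD _ _ Nx Ny)).
Qed.

(** The [f k] need not converge on [N] as homomorphisms are not controlled by
    the defect; a Hahn-Banach limit replaces the pointwise one. *)
Lemma invariant_qm_limit (D : R) (F : nat -> G -> R) :
  (forall k, invariant_qm_on N D (F k)) ->
  exists2 f, invariant_qm_on N D f & forall x r s,
    (\forall k \near \oo, r <= F k x <= s) -> r <= f x.
Proof.
move=> FN.
pose diff k l l' := \sum_(x <- l) F k x - \sum_(x <- l') F k x.
(* The eventual lower bound [s] makes constraints reversible. *)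
pose constraint l l' r := exists s, \forall k \near \oo, s <= diff k l l' <= r.
have [||||f fC] := @hahn_banach_seq R G constraint.
- by exists 0; near=> k; rewrite /diff !big_nil subrr lexx.
- move=> l l' r m m' s [r' lC] [s' mC]; exists (r' + s'); near=> k.
  have : r' <= diff k l l' <= r by near: k.
  have : s' <= diff k m m' <= s by near: k.
  rewrite /diff !big_cat /= => /andP[? ?] /andP[? ?]; apply/andP; split; lra.
- move=> l l' r [s lC]; exists (- s), (- r); near=> k.
  have : s <= diff k l l' <= r by near: k.
  by rewrite /diff => /andP[? ?]; apply/andP; split; lra.
- move=> l l' r [s lC] ll'; near \oo => k.
  have : s <= diff k l l' <= r by near: k.
  by rewrite /diff (perm_big _ ll') subrr => /andP[].
have fC_all l l' s r : (forall k, s <= diff k l l' <= r) ->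
    s <= \sum_(x <- l) f x - \sum_(x <- l') f x <= r.
  move=> lC; apply/andP; split.
    suff /fC : constraint l' l (- s) by lra.
    exists (- r); near=> k; have := lC k.
    by rewrite /diff => /andP[? ?]; apply/andP; split; lra.
  suff /fC : constraint l l' r by lra.
  by exists s; near=> k.
have fC_eq l l' : (forall k, \sum_(x <- l) F k x = \sum_(x <- l') F k x) ->
    \sum_(x <- l) f x = \sum_(x <- l') f x.
  move=> lE; apply/eqP; rewrite -subr_eq0 eq_le.
  by rewrite andbC fC_all// => k; rewrite /diff lE subrr lexx.
exists f; last first.
  move=> x r s xC; suff /fC : constraint [::] [:: x] (- r).
    by rewrite big_nil big_seq1; lra.
  exists (- s); near=> k; have : r <= F k x <= s by near: k.
  by rewrite /diff big_nil big_seq1 => /andP[? ?]; apply/andP; split; lra.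
split.
- move=> x y Nx Ny.
  have := fC_all [:: (x * y)%g] [:: x; y] (- D) D.
  rewrite !big_cons !big_nil !addr0 opprD addrA -ler_norml; apply => k.
  have [FD _ _] := FN k; have := FD x y Nx Ny.
  by rewrite /diff !big_cons !big_nil !addr0 opprD addrA ler_norml.
- move=> x n xN; have := fC_eq [:: (x ^+ n)%g] (nseq n x).
  rewrite big_seq1 big_nseq iter_addr_0 mulr_natl; apply=> k.
  have [_ FX _] := FN k.
  by rewrite big_seq1 big_nseq iter_addr_0 FX// mulr_natl.
- move=> g x xN; have := fC_eq [:: (g * x * g^-1)%g] [:: x].
  by rewrite !big_seq1; apply=> k; have [_ _ FJ] := FN k; rewrite !big_seq1 FJ.
Unshelve. all: by end_near. Qed.

Section Extension.
Hypothesis decomposition : invariant_qm R N =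
  [set h \+ f | h in invariant_hom R N & f in restricted_qm R N].

(** The homomorphism part does not affect the defect, and its invariance makes it vanish on mixed
    commutators. *)
Lemma extend_invariant_qm (D : R) (f : G -> R) : invariant_qm_on N D f ->
  exists f' : G -> R, [/\ homogeneous f', exists D', defect_on [set: G] D' f',
    defect_on [set` N] D f' &
    forall k x, product_of_commutators N k x -> f x = f' x].
Proof.
move=> [fD fX fJ].
have fD_val : defect_on [set: subgroup N] D (f \o val).
  by move=> x y _ _; exact: fD (valP x) (valP y).
have : invariant_qm R N (f \o val).
  split; last by move=> g x; exact/fJ/valP.
  split; first by exists D => x y; exact: fD_val.
  apply: homogeneous_of_powers fD_val _ => x n /=; rewrite -fX; last exact: valP.
  congr f; elim: n => [|n IH]; first by rewrite !expg0.
  by rewrite !expgS -IH.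
rewrite decomposition => -[h [hD hJ] [_ [f' [f'qm f'h] <-] hf]].
have fE x (xN : x \in N) : f x = h (exist _ x xN) + f' x.
  by have := congr1 (@^~ (exist _ x xN)) hf.
pose e x := f x - f' x.
have eM x y : x \in N -> y \in N -> e (x * y)%g = e x + e y.
  move=> xN yN; have xyN : (x * y)%g \in N by exact: gpredM.
  rewrite /e (fE _ xN) (fE _ yN) (fE _ xyN) !addrK -hD.
  by congr h; apply: val_inj.
have eJ g x : x \in N -> e (g * x * g^-1)%g = e x.
  move=> xN; rewrite /e (fE _ xN) (fE _ (gpred_conj g x xN)) !addrK.
  by rewrite -(hJ g (exist _ x xN)); congr h; apply: val_inj.
have N1 : 1%g \in N by exact: gpred1.
have e1 : e 1%g = 0 by apply: (@addrI _ (e 1%g)); rewrite -eM// mulg1 addr0.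
exists f'; split=> //; first by case: f'qm => D' f'D; exists D' => x y _ _.
  move=> x y Nx Ny; have := fD _ _ Nx Ny; have := eM _ _ Nx Ny; rewrite /e => exy.
  by congr (`|_| <= _); lra.
move=> k x xk; apply/eqP; rewrite -subr_eq0 -/(e x); apply/eqP; move: k x xk.
apply: product_of_commutators_ind => // _ g x y xN /product_of_commutators_mem yN ey.
have gxN : (g * x * g^-1)%g \in N by exact: gpred_conj.
have xVN : x^-1%g \in N by rewrite gpredV.
rewrite eM ?ey ?addr0//; last exact: gpredM.
by rewrite eM// eJ// -eM// mulgV.
Qed.

Lemma invariant_qm_bounded_scl (D : R) (f : G -> R) : invariant_qm_on N D f ->
  exists2 K, 0 <= K &
    forall k x, product_of_commutators N k x -> `|f x| <= K * scl R predT x.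
Proof.
move=> /extend_invariant_qm[f' [f'h [D' f'D] _ ff']]; exists (2 * D').
  by rewrite mulr_ge0// (le_trans _ (f'D 1%g 1%g I I)).
move=> k x xk; rewrite (ff' k)//; apply: (@homogeneous_le_scl _ _ _ _ k) => //.
exact: product_of_commutators_sub xk.
Qed.

(* A gliding hump: if no constant works, summing rapidly decaying multiples of
   elements nearly realizing [scl_{G,N}] at successive bad points yields an
   invariant quasimorphism not dominated by any multiple of [scl_G]. *)
Lemma scl_mixed_le_mul_scl : exists2 C : R, 0 < C &
  forall k x, product_of_commutators N k x -> scl R N x <= C * scl R predT x.
Proof.
apply: contrapT => noC.
have bad C : 0 < C -> exists x, (exists k, product_of_commutators N k x) /\
    C * scl R predT x < scl R N x.
  move=> C0; apply: contrapT => nobad; apply: noC; exists C => // k x xk.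
  by rewrite leNgt; apply/negP => Cx; apply: nobad; exists x; split=> //; exists k.
(* The weights after the [n]-th sum to [w n / 3], so later humps leave two thirds of the [n]-th
   one. *)
pose w n : R := 4^-1 ^+ n.
have w_gt0 n : 0 < w n by rewrite exprn_gt0.
have wS n : w n.+1 = 4^-1 * w n by rewrite /w exprS.
(* Boundedness of the defect of [F] is a premise inside [hump], so that [choice] applies to every
   pair [(F, n)] before the partial sums are defined. *)
pose hump (F : G -> R) n (p : G * (G -> R)) :=
  [/\ exists k, product_of_commutators N k p.1,
      invariant_qm_on N 2^-1 p.2, scl R N p.1 <= p.2 p.1 &
      (exists D, invariant_qm_on N D F) -> exists K : R,
        `|F p.1| <= K * scl R predT p.1 /\
        (K + n.+1%:R) * scl R predT p.1 < 2 / 3 * w n * scl R N p.1].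
have hump_exists (Fn : (G -> R) * nat) : exists p, hump Fn.1 Fn.2 p.
  case: Fn => F n; have [K K0 FK] : exists2 K : R, 0 <= K &
      (exists D, invariant_qm_on N D F) ->
      forall k x, product_of_commutators N k x -> `|F x| <= K * scl R predT x.
    case: (pselect (exists D, invariant_qm_on N D F)) => [[D FD]|noD].
      by have [K K0 FK] := invariant_qm_bounded_scl FD; exists K.
    by exists 0.
  have wn0 : 0 < 2 / 3 * w n by rewrite mulr_gt0// divr_gt0.
  have [|x [[k xk] xbad]] := bad ((K + n.+1%:R) / (2 / 3 * w n)).
    by rewrite divr_gt0// ltr_wpDl// ltr0n.
  have [g gN gx] := invariant_qm_ge_scl R xk.
  exists (x, g); split=> //; first by exists k.
  move=> FD; exists K; split; first exact: FK xk.
  by move: xbad; rewrite mulrAC ltr_pdivrMr// [X in _ < X]mulrC.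
have [P PP] := choice hump_exists.
pose fix F n : G -> R := if n is m.+1 then fun x => F m x + w m * (P (F m, m)).2 x
  else fun=> 0.
(* Each hump has defect [1 / 2], and the first [n] weights sum to [4 / 3 * (1 - w n)]. *)
have FN n : invariant_qm_on N (2 / 3 * (1 - w n)) (F n).
  elim: n => [|n IH].
    rewrite /w expr0 subrr mulr0; split=> //= [x y _ _|x n _].
      by rewrite !subr0 normr0.
    by rewrite mulr0.
  have [_ gN _ _] := PP (F n, n).
  have := invariant_qm_on_combination (ltW (w_gt0 n)) IH gN.
  by rewrite wS; congr (invariant_qm_on N _ _); field.
have F_cauchy k x m i : product_of_commutators N k x ->
    `|F (m + i)%N x - F m x| <= 4 / 3 * (w m - w (m + i)%N) * scl R N x.
  move=> xk; elim: i => [|i IH]; first by rewrite addn0 !subrr normr0 mulr0 mul0r.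
  have [_ gN _ _] := PP (F (m + i)%N, (m + i)%N).
  have := invariant_qm_le_scl gN xk; rewrite mulfV ?mul1r//.
  rewrite addnS wS /=; set g := (P _).2.
  move=> /(ler_wpM2l (ltW (w_gt0 (m + i)%N))); rewrite -{1}(gtr0_norm (w_gt0 _)) -normrM.
  move: IH; rewrite !ler_norml => /andP[? ?] /andP[? ?].
  by apply/andP; split; lra.
have FN1 n : invariant_qm_on N 1 (F n).
  by apply: invariant_qm_on_le (FN n); have := w_gt0 n; lra.
have [f fN f_ge] := invariant_qm_limit FN1.
have [K K0 fK] := invariant_qm_bounded_scl fN.
have [n Kn] : exists n : nat, K < n%:R by exists (Num.bound K); exact: archi_boundP.
have [[k xk] gN gx] := PP (F n, n).
have FD : exists D, invariant_qm_on N D (F n) by exists 1; exact: FN1.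
move=> /(_ FD)[Kn' [Fx xbad]].
move: xk gN gx Fx xbad; set x := (P _).1; set g := (P _).2 => /= xk gN gx Fx xbad.
have sG0 : 0 <= scl R predT x.
  exact: (scl_ge0 R (product_of_commutators_sub (M := predT) _ xk)).
have FS : F n.+1 x = F n x + w n * g x by [].
have near_F i : `|F (n.+1 + i)%N x - F n.+1 x| <= 1 / 3 * w n * scl R N x.
  rewrite (le_trans (F_cauchy _ _ _ _ xk))// ler_wpM2r ?(scl_ge0 R xk)//.
  by have := w_gt0 (n.+1 + i)%N; rewrite wS; lra.
have wgx : w n * scl R N x <= w n * g x by rewrite ler_wpM2l// ltW.
(* By the choice of [x], the left side exceeds [n.+1] times [scl_G x], hence [K] times it,
   contradicting [fK]. *)
suff lower : 2 / 3 * w n * scl R N x - Kn' * scl R predT x <= f x.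
  have := fK _ _ xk; have := ler_norm (f x).
  have : K * scl R predT x <= n.+1%:R * scl R predT x.
    by rewrite ler_wpM2r// ltW// (lt_trans Kn)// ltr_nat.
  by move: xbad; rewrite mulrDl; lra.
apply: (f_ge _ _ (F n.+1 x + 1 / 3 * w n * scl R N x)).
near=> j; have nj : (n < j)%N by near: j; exact: nbhs_infty_gt.
have := near_F (j - n.+1)%N; rewrite subnKC// FS; move: Fx.
rewrite !ler_norml => /andP[? ?] /andP[? ?].
by apply/andP; split; lra.
Unshelve. all: by end_near. Qed.

End Extension.

End Decomposition.

(** * Comparison of the stable commutator lengths of [G] and of the pair *)

Theorem theorem2p1 (R : realType) (G : groupType) (N : normalSubgroup G) :
  invariant_qm R N =
    [set h \+ f | h in invariant_hom R N & f in restricted_qm R N] ->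
  [/\ bilipschitz_equivalent_on (commutator_subgroup [set: G] [set` N])
        (scl R predT) (scl R N),
      amenable R (quotient_group N) ->
        forall x : G, commutator_subgroup [set: G] [set` N] x ->
          scl R predT x <= scl R N x <= 2%:R * scl R predT x
    & solvable_group (quotient_group N) ->
        forall x : G, commutator_subgroup [set: G] [set` N] x ->
          scl R predT x = scl R N x].
Proof.
move=> decomposition.
have scl_le x k : product_of_commutators N k x -> scl R predT x <= scl R N x.
  by move=> xk; apply: scl_sub xk.
(* The duality provides defect [1 / 2] on [N]; a defect [c / 2] on [G] becomes the factor [c] in
   [homogeneous_le_scl]. *)
have le_scl c x k : product_of_commutators N k x ->
    (forall f : G -> R, homogeneous f -> (exists D, defect_on [set: G] D f) ->
      defect_on [set` N] 2^-1 f -> defect_on [set: G] (c / 2) f) ->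
    scl R N x <= c * scl R predT x.
  move=> xk defect_le; have [f fN fx] := invariant_qm_ge_scl R xk.
  have [f' [f'h f'D f'N ff']] := extend_invariant_qm decomposition fN.
  rewrite (le_trans fx)// (ff' _ _ xk) (le_trans (ler_norm _))//.
  have := homogeneous_le_scl (defect_le _ f'h f'D f'N) f'h
    (product_of_commutators_sub (M := predT) (fun _ _ => isT) xk).
  by rewrite mulrCA mulfV ?mulr1.
split.
- have [C C0 sclC] := scl_mixed_le_mul_scl decomposition.
  exists C^-1, 1; split; [by rewrite invr_gt0|by []|move=> x].
  move=> /commutator_subgroup_product[k xk].
  by rewrite mul1r (scl_le _ _ xk) andbT mulrC ler_pdivrMr// mulrC (sclC _ _ xk).
- move=> amenN x /commutator_subgroup_product[k xk]; rewrite (scl_le _ _ xk)/=.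
  apply: (le_scl _ _ _ xk) => f fh [D fD] fN.
  by rewrite -[_ / _]/(2 * 2^-1); exact: defect_amenable fD fh _ fN amenN.
- move=> solvN x /commutator_subgroup_product[k xk]; apply/le_anti.
  rewrite (scl_le _ _ xk)/= -[leRHS]mul1r; apply: (le_scl _ _ _ xk) => f fh [D fD] fN.
  by rewrite mul1r; exact: defect_solvable fD fh _ solvN fN.
Qed.
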